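(* For every positive integer $n$, the group $\mathrm{AGL}(n,2)$, in its natural action on $V=\mathbb{F}_2^n$, satisfies the strict-EKR property: every intersecting subset of $\mathrm{AGL}(n,2)$ of maximum possible size is of the form $\{g\in\mathrm{AGL}(n,2): g(\alpha)=\beta\}$ for some $\alpha,\beta\in V$.
   Context: $\mathrm{AGL}(n,2)=\mathrm{GL}(n,2)\ltimes V$, where $V=\mathbb{F}_2^n$; its elements are pairs $(M,v)$ with $M\in\mathrm{GL}(n,2)$, $v\in V$, with product $(M_1,v_1)(M_2,v_2)=(M_1M_2,v_1+M_1v_2)$, acting on $V$ by $(M,v)\cdot w=v+Mw$. For a finite permutation group $G\le\mathrm{Sym}(\Omega)$, two elements $g_1,g_2\in G$ are intersecting if $g_1g_2^{-1}$ fixes a point of $\Omega$; a subset $S\subseteq G$ is an intersecting set if every pair of its elements is intersecting. The sets $\mathcal{S}_{\alpha\to\beta}=\{g\in G: g(\alpha)=\beta\}$ ($\alpha,\beta\in\Omega$) are the canonical intersecting sets. $G$ satisfies the strict-EKR property if every intersecting set of maximum possible size in $G$ is canonical. *)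

(* Defs.v *)
From HB Require Import structures.
From mathcomp Require Import all_boot all_order all_algebra all_fingroup.

Set Implicit Arguments.
Unset Strict Implicit.
Unset Printing Implicit Defensive.

Import GRing.Theory.

(* MathComp multiplies permutations from left to right, (s * t) x = t (s x).
   [intersecting] does not depend on that choice: in either convention
   g1 * g2^-1 fixes a point iff g1 and g2 agree at some point
   (lemma [intersectingE]). *)
Section EKR.

Local Open Scope group_scope.

Variable T : finType.
Implicit Types (g : {perm T}) (S : {set {perm T}}) (G : {group {perm T}}).

Definition intersecting g1 g2 : bool := [exists x, (g1 * g2^-1) x == x].

Definition intersecting_set S : bool :=
  [forall g1 in S, forall g2 in S, intersecting g1 g2].

Definition max_intersecting G S : Prop :=
  [/\ S \subset G, intersecting_set S
    & forall S', S' \subset G -> intersecting_set S' -> (#|S'| <= #|S|)%N].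

Definition canonical_set G (a b : T) : {set {perm T}} :=
  [set g in G | g a == b].

Definition strict_EKR G : Prop :=
  forall S, max_intersecting G S -> exists a b, S = canonical_set G a b.

Lemma intersectingE g1 g2 : intersecting g1 g2 = [exists x, g1 x == g2 x].
Proof.
by apply: eq_existsb => x; rewrite permM (canF_eq (permKV g2)).
Qed.

End EKR.

Section AffineGroup.

Variable n : nat.

(* As in {'GL_n(2)}, dimension n is encoded as n.-1.+1; the two are equal
   exactly when 0 < n, so these definitions are meant for positive n. *)
Definition affine_space : finType := 'cV['F_2]_n.-1.+1.

Record agl : predArgType :=
  Agl { agl_lin : {'GL_n(2)}; agl_trans : affine_space }.

Definition pair_of_agl (g : agl) := (agl_lin g, agl_trans g).
Definition agl_of_pair (p : {'GL_n(2)} * affine_space) := Agl p.1 p.2.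

Lemma pair_of_aglK : cancel pair_of_agl agl_of_pair.
Proof. by case. Qed.

HB.instance Definition _ := Finite.copy agl (can_type pair_of_aglK).

Local Open Scope ring_scope.

Definition agl_one : agl := Agl 1%g (0 : 'cV_n.-1.+1).

Definition agl_mul (g h : agl) : agl :=
  Agl (agl_lin g * agl_lin h)%g
      (agl_trans g + agl_lin g *m agl_trans h : 'cV_n.-1.+1).

Definition agl_inv (g : agl) : agl :=
  Agl (agl_lin g)^-1%g
      (- (GLval (agl_lin g)^-1%g *m agl_trans g) : 'cV_n.-1.+1).

Lemma agl_mulA : associative agl_mul.
Proof.
move=> [A a] [B b] [C c]; rewrite /agl_mul /= mulgA.
by rewrite mulmxDr mulmxA addrA.
Qed.

Lemma agl_mul1 : left_id agl_one agl_mul.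
Proof. by move=> [A a]; rewrite /agl_mul /= mul1g mul1mx add0r. Qed.

Lemma agl_mulV : left_inverse agl_one agl_inv agl_mul.
Proof. by move=> [A a]; rewrite /agl_mul /= mulVg addNr. Qed.

HB.instance Definition _ :=
  Finite_isGroup.Build agl agl_mulA agl_mul1 agl_mulV.

Definition agl_act (g : agl) (w : affine_space) : affine_space :=
  (agl_trans g + agl_lin g *m w : 'cV_n.-1.+1).

Lemma agl_act1 w : agl_act 1%g w = w.
Proof. by rewrite /agl_act /= mul1mx add0r. Qed.

Lemma agl_actM g h w : agl_act (g * h)%g w = agl_act g (agl_act h w).
Proof. by rewrite /agl_act /= mulmxDr mulmxA addrA. Qed.

Lemma agl_actK g : cancel (agl_act g) (agl_act g^-1%g).
Proof. by move=> w; rewrite -agl_actM mulVg agl_act1. Qed.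

Definition agl_perm (g : agl) : {perm affine_space} :=
  perm (can_inj (agl_actK g)).

Lemma agl_permE g w : agl_perm g w = agl_act g w.
Proof. by rewrite permE. Qed.

(* Composition of functions, hence reversed for the product of permutations. *)
Lemma agl_permM g h : agl_perm (g * h)%g = (agl_perm h * agl_perm g)%g.
Proof. by apply/permP=> w; rewrite permM !agl_permE agl_actM. Qed.

Lemma agl_perm_inj : injective agl_perm.
Proof.
move=> [A a] [B b] /permP eq_gh.
have eq_act w : (a + A *m w = b + B *m w :> 'cV_n.-1.+1).
  by have := eq_gh w; rewrite !agl_permE.
have eq_ab : a = b by have := eq_act 0; rewrite !mulmx0 !addr0.
congr Agl => //; apply/val_inj/matrixP => i j /=.
have := eq_act (delta_mx j 0); rewrite eq_ab => /addrI.
by rewrite -!colE => /matrixP/(_ i 0); rewrite !mxE.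
Qed.

Definition AGL : {set {perm affine_space}} := [set agl_perm g | g : agl].

Lemma AGL_group_set : group_set AGL.
Proof.
apply/group_setP; split=> [|_ _ /imsetP[g _ ->] /imsetP[h _ ->]].
  apply/imsetP; exists 1%g => //.
  by apply/permP=> w; rewrite agl_permE agl_act1 perm1.
by rewrite -agl_permM imset_f.
Qed.

Canonical AGL_group := Group AGL_group_set.

End AffineGroup.

(* Main.v *)
Require Import Defs.
From mathcomp Require Import all_boot all_order all_algebra all_fingroup.

(** A maximum intersecting set contains exactly one pair (A, f A) for each
    A in GL(n,2), and the intersection condition reads: f A - f B lies in the
    image of A - B. Dually, for every row vector u the scalar u (f A) depends
    only on u A; write it h u (u A). Linearity in u gives
    h (u + v) (x + y) = h u x + h v y for independent pairs (u, v), (x, y).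
    Exchanging x and y yields h u x + h v y = h u y + h v x, so that
    h u x = r u + c x, and the same equation makes c affine. Over F_2 distinct
    nonzero vectors are independent, so c x = x a + const for all x != 0, which
    says that f A - A a is constant. *)

Set Implicit Arguments.
Unset Strict Implicit.
Unset Printing Implicit Defensive.

Import GRing.Theory.
Local Open Scope ring_scope.

(** * Linear algebra, mostly over F_2 *)

(** [pinvmx U *m W] sends [U] to [W] but may be singular; as it preserves the rank of [U], some
    invertible matrix agrees with it on [U]. *)
Lemma row_free_transitive (F : fieldType) (m n : nat) (U W : 'M[F]_(m, n)) :
  row_free U -> row_free W -> exists2 A, A \in unitmx & U *m A = W.
Proof.
move=> freeU freeW.
have UK : U *m (pinvmx U *m W) = W.
  by rewrite mulmxA mulmxVp // mul1mx.
have [|A unitA] := @complete_unitmx _ m n U (pinvmx U *m W).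
  by rewrite UK (eqP freeU) (eqP freeW).
by rewrite UK => ->; exists A.
Qed.

Lemma F2_cases (a : 'F_2) : a = 0 \/ a = 1.
Proof. by case: a => [[|[|//]] lt_a]; [left | right]; apply: val_inj. Qed.

Lemma F2_mx_oppr (m n : nat) (M : 'M['F_2]_(m, n)) : - M = M.
Proof.
by apply/matrixP=> i j; rewrite mxE; case: (F2_cases (M i j)) => ->;
  apply: val_inj.
Qed.

Lemma F2_mx_addrr (m n : nat) (M : 'M['F_2]_(m, n)) : M + M = 0.
Proof. by rewrite -{2}[M]F2_mx_oppr subrr. Qed.

Lemma F2_mx_addr_neq0 (m n : nat) (M N : 'M['F_2]_(m, n)) :
  M != N -> M + N != 0.
Proof. by rewrite -{2}[N]F2_mx_oppr subr_eq0. Qed.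

Lemma F2_row_free2 (n : nat) (u v : 'rV['F_2]_n) :
  u != 0 -> v != 0 -> u != v -> row_free (col_mx u v).
Proof.
move=> u0 v0 /F2_mx_addr_neq0 uv; apply/inj_row_free => w.
rewrite -[w]hsubmxK mul_row_col [lsubmx w]mx11_scalar [rsubmx w]mx11_scalar.
rewrite !mul_scalar_mx.
case: (F2_cases (lsubmx w 0 0)) => ->; case: (F2_cases (rsubmx w 0 0)) => ->;
  rewrite ?scale0r ?scale1r ?add0r ?addr0 => E.
- by rewrite raddf0 row_mx0.
- by rewrite E eqxx in v0.
- by rewrite E eqxx in u0.
- by rewrite E eqxx in uv.
Qed.

(** The only scalars are 0 and 1, so additivity already gives linearity. *)
Lemma F2_additive_rowE (n : nat) (c : 'rV['F_2]_n -> 'F_2) :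
  c 0 = 0 -> {morph c : x y / x + y} ->
  exists a : 'cV_n, forall x, c x = (x *m a) 0 0.
Proof.
move=> c0 cD; exists (\col_j c (delta_mx 0 j)) => x.
rewrite {1}[x]row_sum_delta (big_morph c cD c0) !mxE.
apply: eq_bigr => j _; rewrite mxE.
by case: (F2_cases (x 0 j)) => ->; rewrite ?scale0r ?scale1r ?mul0r ?mul1r.
Qed.

(** * Separation of variables *)

Section SeparateVariables.

Variables (n : nat) (h : 'rV['F_2]_n -> 'rV['F_2]_n -> 'F_2).
Hypothesis hD : forall u v x y,
  u != 0 -> v != 0 -> u != v -> x != 0 -> y != 0 -> x != y ->
  h (u + v) (x + y) = h u x + h v y.

(** When [u != v] and [x != y], both sides equal [h (u + v) (x + y)]; the other cases are
    trivial. *)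
Lemma biadditive_swap u v x y : u != 0 -> v != 0 -> x != 0 -> y != 0 ->
  h u x + h v y = h u y + h v x.
Proof.
move=> u0 v0 x0 y0.
have [->|uv] := eqVneq u v; first by rewrite addrC.
have [->//|xy] := eqVneq x y.
rewrite -(hD u0 v0 uv x0 y0 xy) [x + y]addrC.
by apply: hD; rewrite // eq_sym.
Qed.

Lemma biadditive_separate (u0 v0 : 'rV['F_2]_n) :
    u0 != 0 -> v0 != 0 -> u0 != v0 ->
  exists (r : 'rV['F_2]_n -> 'F_2) (a : 'cV_n),
    forall u x, u != 0 -> x != 0 -> h u x = r u + (x *m a) 0 0.
Proof.
move=> u0_neq0 v0_neq0 uv0.
pose r u := h u u0 - h u0 u0; pose c x := h u0 x.
have h_split u x : u != 0 -> x != 0 -> h u x = r u + c x.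
  move=> u_neq0 x_neq0; rewrite /r /c addrAC.
  by rewrite -(biadditive_swap u_neq0 u0_neq0 x_neq0 u0_neq0) addrK.
(* Two expansions of [h (u0 + v0) (x + y)] are compared: the defect [s] involves only [u0] and
   [v0]. *)
have [s cD] : exists s, forall x y, x != 0 -> y != 0 -> x != y ->
    c (x + y) = c x + c y + s.
  exists (r u0 + r v0 - r (u0 + v0)) => x y x_neq0 y_neq0 xy.
  apply: (addrI (r (u0 + v0))).
  rewrite -(h_split _ _ (F2_mx_addr_neq0 uv0) (F2_mx_addr_neq0 xy)) hD //.
  rewrite (h_split _ _ u0_neq0 x_neq0) (h_split _ _ v0_neq0 y_neq0).
  by rewrite addrACA addrC [RHS]addrC -[RHS]addrA subrK.
(* [hD] concerns nonzero vectors only, so the value at 0 is set by hand; elsewhere adding [s]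
   absorbs the defect. *)
pose c' x := if x == 0 then 0 else c x + s.
have c'0 : c' 0 = 0 by rewrite /c' eqxx.
have c'D : {morph c' : x y / x + y}.
  move=> x y; have [->|x_neq0] := eqVneq x 0; first by rewrite c'0 !add0r.
  have [->|y_neq0] := eqVneq y 0; first by rewrite c'0 !addr0.
  have [->|xy] := eqVneq x y.
    by rewrite F2_mx_addrr c'0; case: (F2_cases (c' y)) => ->; apply: val_inj.
  rewrite /c' (negPf x_neq0) (negPf y_neq0) (negPf (F2_mx_addr_neq0 xy)).
  by rewrite cD // addrACA addrA.
have [a c'E] := F2_additive_rowE c'0 c'D.
exists (fun u => r u - s), a => u x u_neq0 x_neq0.
by rewrite h_split // -c'E /c' (negPf x_neq0) [c x + s]addrC addrA subrK.
Qed.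

End SeparateVariables.

(** * Affine maps that agree pairwise at a point *)

Section LocallyAffine.

Variables (n : nat) (f : 'M['F_2]_n -> 'cV['F_2]_n).
Hypothesis f_agree : forall A B, A \in unitmx -> B \in unitmx ->
  exists w, f A + A *m w = f B + B *m w.

(** If [u *m A = u *m B], multiplying the agreement equation by [u] cancels the terms in [w]. Hence
    any invertible matrix sending [u] to [x] can define [h u x]. *)
Lemma row_function_exists :
  exists h : 'rV['F_2]_n -> 'rV['F_2]_n -> 'F_2,
    forall u A, A \in unitmx -> (u *m f A) 0 0 = h u (u *m A).
Proof.
pose mx_sending (u x : 'rV_n) : 'M['F_2]_n :=
  odflt 1%:M [pick A in unitmx | u *m A == x].
exists (fun u x => (u *m f (mx_sending u x)) 0 0) => u A unitA.
rewrite /mx_sending.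
case: pickP => [B /andP[unitB /eqP uBA] | /(_ A)]; last by rewrite unitA eqxx.
have [w /(congr1 (mulmx u))] := f_agree unitA unitB.
by rewrite !mulmxDr !mulmxA /= uBA => /addIr ->.
Qed.

Lemma locally_affine : exists a b, forall A, A \in unitmx -> f A + A *m a = b.
Proof.
have [h hE] := row_function_exists.
have hD u v x y : u != 0 -> v != 0 -> u != v -> x != 0 -> y != 0 -> x != y ->
    h (u + v) (x + y) = h u x + h v y.
  move=> u_neq0 v_neq0 uv x_neq0 y_neq0 xy.
  (* One invertible [A] carries [u] to [x] and [v] to [y], so all three values of [h] come from the
     same [f A]. *)
  have [A unitA] := row_free_transitive (F2_row_free2 u_neq0 v_neq0 uv)
                                        (F2_row_free2 x_neq0 y_neq0 xy).
  rewrite mul_col_mx => /eq_col_mx[<- <-].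
  by rewrite -mulmxDl -!hE // mulmxDl mxE.
have delta_neq0 i : delta_mx 0 i != 0 :> 'rV['F_2]_n.
  by apply/eqP=> /rowP/(_ i)/eqP; rewrite !mxE !eqxx oner_eq0.
have [r [a ha]] : exists (r : 'rV['F_2]_n -> 'F_2) (a : 'cV_n),
    forall i A, A \in unitmx ->
    h (delta_mx 0 i) (row i A) = r (delta_mx 0 i) + (row i A *m a) 0 0.
  have row_neq0 i (A : 'M['F_2]_n) : A \in unitmx -> row i A != 0.
    move=> unitA; apply: contra_neq (delta_neq0 i) => rowA0.
    by rewrite -[delta_mx 0 i](mulmxK unitA) -rowE rowA0 mul0mx.
  (* Two distinct basis vectors, if they exist, start the separation of variables. *)
  case: (pickP (fun p : 'I_n * 'I_n => p.1 != p.2)) => [[i j] /= ij | one_dim].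
    have [|r [a ha]] := biadditive_separate hD (delta_neq0 i) (delta_neq0 j).
      apply/eqP=> /rowP/(_ i)/eqP; rewrite !mxE !eqxx (negPf ij).
      by rewrite oner_eq0.
    by exists r, a => k A unitA; rewrite ha ?row_neq0.
  (* With at most one index, every nonzero row is the basis vector, so [h] takes a constant value
     and [a = 0] works. *)
  have one_row (u : 'rV['F_2]_n) i : u != 0 -> u = delta_mx 0 i.
    move=> u_neq0; apply/rowP=> j; have /= /negbFE/eqP-> := one_dim (j, i).
    rewrite mxE !eqxx; case: (F2_cases (u 0 i)) => // ui0.
    case/eqP: u_neq0; apply/rowP=> k.
    by have /= /negbFE/eqP-> := one_dim (k, i); rewrite ui0 mxE.
  exists (fun u => h u u), 0 => i A unitA.
  by rewrite mulmx0 mxE addr0 (one_row _ i (row_neq0 i A unitA)).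
exists (- a), (\col_i r (delta_mx 0 i)) => A unitA.
apply/colP=> i; rewrite mulmxN [RHS]mxE [LHS]mxE.
have -> : f A i 0 = r (delta_mx 0 i) + (row i A *m a) 0 0.
  by rewrite -ha // rowE -hE // -rowE mxE.
by rewrite -row_mul !mxE addrK.
Qed.

End LocallyAffine.

(** * Intersecting sets in AGL(n,2) *)

Lemma canonical_set_intersecting (T : finType) (G : {group {perm T}}) (a b : T) :
  intersecting_set (canonical_set G a b).
Proof.
apply/forall_inP=> g; rewrite inE => /andP[_ /eqP ga].
apply/forall_inP=> k; rewrite inE => /andP[_ /eqP ka].
by rewrite intersectingE; apply/existsP; exists a; rewrite ga ka.
Qed.

Lemma intersecting_AGL_lin_inj (n : nat) (S : {set {perm affine_space n}})
    (g k : agl n) :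
  intersecting_set S -> agl_perm g \in S -> agl_perm k \in S ->
  agl_lin g = agl_lin k -> g = k.
Proof.
move=> intS gS kS; have /forall_inP/(_ _ kS) := forall_inP intS _ gS.
rewrite intersectingE => /existsP[w]; rewrite !agl_permE /agl_act.
by case: g k {gS kS} => [A v] [B w'] /= + AB; rewrite AB => /eqP/addIr ->.
Qed.

(** Counting: the linear part is injective on [S], while the stabilizer of 0 is intersecting and
    contains a copy of GL(n,2), so by maximality [S] has at least as many elements as GL(n,2). *)
Lemma max_intersecting_AGL_lin_surj (n : nat) (S : {set {perm affine_space n}})
    (M : {'GL_n(2)}) :
  max_intersecting (AGL_group n) S ->
  exists2 g : agl n, agl_perm g \in S & agl_lin g = M.
Proof.
case=> sSG intS maxS; pose P := [set g : agl n | agl_perm g \in S].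
have SE : S = @agl_perm n @: P.
  apply/setP=> p; apply/idP/imsetP=> [pS | [g]]; last by rewrite inE => + ->.
  have /imsetP[g _ pE] := subsetP sSG p pS.
  by exists g; rewrite // inE -pE.
pose lin (g : agl n) := agl_lin g.
have lin_inj : {in P &, injective lin}.
  by move=> g k; rewrite !inE; apply: intersecting_AGL_lin_inj.
pose stab0 (A : {'GL_n(2)}) : {perm affine_space n} := agl_perm (Agl A 0).
have stab0_inj : injective stab0 by move=> A B /agl_perm_inj[].
have linP : lin @: P = setT.
  apply/eqP; rewrite eqEcard subsetT (card_in_imset lin_inj).
  rewrite -(card_imset _ (@agl_perm_inj n)) -SE -(card_imset _ stab0_inj).
  have zero_sub : stab0 @: setT \subset canonical_set (AGL_group n) 0 0.
    apply/subsetP=> _ /imsetP[A _ ->]; rewrite inE.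
    apply/andP; split; first exact: imset_f.
    by rewrite agl_permE /agl_act /= mulmx0 addr0.
  apply: leq_trans (subset_leq_card zero_sub) (maxS _ _ _).
    by apply/subsetP=> p; rewrite inE => /andP[].
  exact: canonical_set_intersecting.
have /imsetP[g] : M \in lin @: P by rewrite linP inE.
by rewrite inE => gS ->; exists g.
Qed.

Theorem theorem1p1 (n : nat) (hn : (0 < n)%N) : strict_EKR (AGL_group n).
Proof.
move=> S maxS; have [sSG intS maxS'] := maxS.
pose over (A : 'M_n.-1.+1) (g : agl n) :=
  (agl_perm g \in S) && (GLval (agl_lin g) == A).
(* The default [1%g] is never reached for invertible [A], since [S] has an element over each of
   them. *)
pose f A := agl_trans (odflt 1%g [pick g | over A g]).
have fP (A : 'M['F_2]_n.-1.+1) : A \in unitmx ->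
    exists g : agl n, [/\ agl_perm g \in S, GLval (agl_lin g) = A & agl_trans g = f A].
  move=> unitA; rewrite /f; case: pickP => [g /andP[gS /eqP gA] | no_g].
    by exists g.
  have [g gS gA] := max_intersecting_AGL_lin_surj (FinRing.unit _ unitA) maxS.
  by have := no_g g; rewrite /over gS gA eqxx.
have f_agree A B : A \in unitmx -> B \in unitmx ->
    exists w, f A + A *m w = f B + B *m w.
  move=> /fP[g [gS <- <-]] /fP[k [kS <- <-]].
  have /forall_inP/(_ _ kS) := forall_inP intS _ gS.
  rewrite intersectingE => /existsP[w /eqP].
  by rewrite !agl_permE; exists w.
have [a [b fab]] := locally_affine f_agree.
(* By [fab] every element of [S] sends [a] to [b]; maximality of [S] turns this inclusion into
   equality. *)
exists a, b; apply/eqP; rewrite eqEcard; apply/andP; split; last first.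
  apply: maxS'; last exact: canonical_set_intersecting.
  by apply/subsetP=> p; rewrite inE => /andP[].
apply/subsetP=> p pS; rewrite inE (subsetP sSG p pS) /=.
have /imsetP[g _ pE] := subsetP sSG p pS; rewrite pE in pS *.
have unit_g : GLval (agl_lin g) \in unitmx by apply: (valP (agl_lin g)).
have [k [kS /val_inj kg fk]] := fP _ unit_g.
rewrite -(fab _ unit_g) -fk (intersecting_AGL_lin_inj intS kS pS kg).
by rewrite agl_permE.
Qed.
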